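(* Let $q\ge 3$ and $p\ge 2q-1$ be integers, and let $\mathcal{F}$ be the family of all $K_q$-free graphs (graphs not containing $K_q$ as a subgraph). Then $$f(n,K_p|\mathcal{F})=g(n,K_p|\langle K_q\rangle)+1=(1+o(1))\,\mathrm{ex}\bigl(n,K_{\lceil p/(q-1)\rceil}\bigr)$$ as $n\to\infty$.
   Context: For a graph $F$, $\langle F\rangle$ is the family of all graphs containing $F$ as a subgraph (not necessarily induced). $\mathrm{ex}(n,F)$ is the Turán number: the maximum number of edges in a graph of order $n$ containing no subgraph isomorphic to $F$. In an edge coloring of $K_n$ (not necessarily proper), for a copy $G'\subseteq K_n$ of a graph $G$, a color class of $G'$ is the graph (without isolated vertices) formed by all edges of $G'$ having a given color that occurs in $G'$. If $K_2\in\mathcal{F}$ and $n\ge|G|$, then $f(n,G|\mathcal{F})$ is the smallest integer $m$ such that in every edge coloring of $K_n$ using at least $m$ colors there exists a copy of $G$ in which all color classes are members of $\mathcal{F}$. If $K_2\notin\mathcal{F}$ and $n\ge|G|$, then $g(n,G|\mathcal{F})$ is the largest integer $m$ for which there exists an edge coloring of $K_n$ using exactly $m$ colors such that every copy of $G$ contains a color class which is a member of $\mathcal{F}$; if no such coloring exists, then $g(n,G|\mathcal{F}):=0$. *)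

(* Defs.v *)
From mathcomp Require Import all_boot.
From mathcomp Require Import boolp classical_sets.

Set Implicit Arguments.
Unset Strict Implicit.
Unset Printing Implicit Defensive.

Record sgraph := SGraph {
  vert :> finType;
  adj : rel vert;
  adj_sym : symmetric adj;
  adj_irr : irreflexive adj
}.

Lemma neq_symmetric (T : eqType) : symmetric (fun x y : T => x != y).
Proof. by move=> x y; rewrite eq_sym. Qed.

Lemma neq_irreflexive (T : eqType) : irreflexive (fun x y : T => x != y).
Proof. by move=> x; rewrite eqxx. Qed.

Definition complete (n : nat) : sgraph :=
  @SGraph 'I_n (fun x y => x != y) (@neq_symmetric _) (@neq_irreflexive _).

Definition edges (G : sgraph) : {set {set G}} :=
  [set [set p.1; p.2] | p : G * G & adj p.1 p.2].

(* A copy of G in H is given by an injective homomorphism G -> H; its edges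
   are the images of the edges of G. *)
Definition embedding (G H : sgraph) (phi : G -> H) : Prop :=
  injective phi /\ forall x y : G, adj x y -> adj (phi x) (phi y).

Definition subgraph (G H : sgraph) : Prop :=
  exists phi : G -> H, embedding phi.

(* Families of graphs; all those considered below are closed under
   isomorphism. *)
Definition graph_family := sgraph -> Prop.

Definition containing (F : sgraph) : graph_family := fun H => subgraph F H.

Definition excluding (F : sgraph) : graph_family := fun H => ~ subgraph F H.

Section EdgeGraph.
Variables (T : finType) (E : {set {set T}}).

Let edge_adj (u v : {x : T | x \in finset.cover E}) : bool :=
  (u != v) && ([set val u; val v] \in E).

Lemma edge_adj_sym : symmetric edge_adj.
Proof. by move=> u v; rewrite /edge_adj eq_sym finset.setUC. Qed.

Lemma edge_adj_irr : irreflexive edge_adj.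
Proof. by move=> u; rewrite /edge_adj eqxx. Qed.

(* The graph without isolated vertices whose edges are the pairs in E. *)
Definition edge_graph : sgraph := SGraph edge_adj_sym edge_adj_irr.

End EdgeGraph.

(* Only the values of a coloring on edges H are ever used. *)
Definition coloring (H : sgraph) := {set H} -> nat.

Definition ncolors (H : sgraph) (c : coloring H) : nat :=
  size (undup [seq c e | e in edges H]).

Section ColorClasses.
Variables (G H : sgraph) (c : coloring H) (phi : G -> H).

Definition copy_edges : {set {set H}} :=
  [set [set phi x | x in e] | e : {set G} in edges G].

Definition occurs (k : nat) : Prop := exists2 e, e \in copy_edges & c e = k.

Definition color_class (k : nat) : sgraph :=
  edge_graph [set e in copy_edges | c e == k].

End ColorClasses.

Definition is_least (P : nat -> Prop) (m : nat) : Prop :=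
  P m /\ forall k, P k -> m <= k.

Definition is_greatest (P : nat -> Prop) (m : nat) : Prop :=
  P m /\ forall k, P k -> k <= m.

(* Both default to 0 when there is no such number. *)
Definition least (P : nat -> Prop) : nat := xget 0 [set m | is_least P m]%classic.

Definition greatest (P : nat -> Prop) : nat :=
  xget 0 [set m | is_greatest P m]%classic.

Definition turan_size (n : nat) (F : sgraph) (m : nat) : Prop :=
  exists G : sgraph, [/\ #|G| = n, ~ subgraph F G & #|edges G| = m].

Definition turan (n : nat) (F : sgraph) : nat := greatest (turan_size n F).

Definition f_property (n : nat) (G : sgraph) (F : graph_family) (m : nat) : Prop :=
  forall c : coloring (complete n), m <= ncolors c ->
    exists2 phi : G -> complete n, embedding phi &
      forall k, occurs c phi k -> F (color_class c phi k).

Definition f_num (n : nat) (G : sgraph) (F : graph_family) : nat :=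
  least (f_property n G F).

Definition g_property (n : nat) (G : sgraph) (F : graph_family) (m : nat) : Prop :=
  exists2 c : coloring (complete n), ncolors c = m &
    forall phi : G -> complete n, embedding phi ->
      exists2 k, occurs c phi k & F (color_class c phi k).

Definition g_num (n : nat) (G : sgraph) (F : graph_family) : nat :=
  greatest (g_property n G F).

Lemma leastP (P : nat -> Prop) : (exists m, P m) -> is_least P (least P).
Proof.
case=> m Pm; apply: (@xgetPex _ 0 [set m | is_least P m]%classic).
have ex_b : exists m, `[< P m >] by exists m; apply/asboolP.
case: (ex_minnP ex_b) => i /asboolP Pi le_i.
by exists i; split=> // k Pk; apply/le_i/asboolP.
Qed.

Lemma greatestP (P : nat -> Prop) (b : nat) :
  (exists m, P m) -> (forall m, P m -> m <= b) -> is_greatest P (greatest P).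
Proof.
case=> m Pm Pb; apply: (@xgetPex _ 0 [set m | is_greatest P m]%classic).
have ex_b : exists m, `[< P m >] by exists m; apply/asboolP.
have le_b k : `[< P k >] -> k <= b by move/asboolP/Pb.
case: (ex_maxnP ex_b le_b) => i /asboolP Pi le_i.
by exists i; split=> // k Pk; apply/le_i/asboolP.
Qed.

Lemma ncolors_le (H : sgraph) (c : coloring H) : ncolors c <= #|edges H|.
Proof. by rewrite (leq_trans (size_undup _)) ?size_image. Qed.

Lemma f_numP (n : nat) (G : sgraph) (F : graph_family) :
  is_least (f_property n G F) (f_num n G F).
Proof.
apply: leastP; exists #|edges (complete n)|.+1 => c.
by rewrite ltnNge ncolors_le.
Qed.

Lemma g_numP (n : nat) (G : sgraph) (F : graph_family) :
  (exists m, g_property n G F m) ->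
  is_greatest (g_property n G F) (g_num n G F).
Proof.
move=> exm; apply: (greatestP (b := #|edges (complete n)|)) exm _.
by move=> m [c <- _]; apply: ncolors_le.
Qed.

Lemma turanP (n : nat) (F : sgraph) :
  (exists m, turan_size n F m) -> is_greatest (turan_size n F) (turan n F).
Proof.
move=> exm; apply: (greatestP (b := 2 ^ n)) exm _ => m [G [<- _ <-]].
rewrite -[#|G|]cardsT -card_powerset.
apply/subset_leq_card/fintype.subsetP => e _.
by rewrite powersetE finset.subsetT.
Qed.

(* Main.v *)
Require Import Defs.
From HB Require Import structures.
From mathcomp Require Import all_boot all_order all_algebra.
From mathcomp Require Import all_classical all_reals all_analysis.
From mathcomp Require Import zify ring lra.
Import Order.TTheory GRing.Theory Num.Theory.
Import numFieldNormedType.Exports.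

(** Write t = ceil(p / (q - 1)) and s = t - 1, so that s (q - 1) < p <= t (q - 1)
    and s >= 2. Call a coloring bad if every copy of K_p has a color class
    containing K_q. Then f > m holds exactly when some bad coloring has at least m
    colors, so f = g + 1 is formal as soon as there is a bad coloring.

    Both f and ex(n, K_t) turn out to be (1 - 1/s + o(1)) n^2 / 2. For ex this is
    Turan's theorem (turan_upper) and the Turan graph with s parts
    (card_turan_graph). For the lower bound on f, give the edges of the Turan
    graph different colors and all remaining edges one further color. As
    p > s (q - 1), each copy of K_p has q vertices in one part, and these span a
    monochromatic K_q (turan_coloring).

    The upper bound on f comes from using Turan's theorem q - 1 times. Take one edge of each color, and forget the O(n) colors that have more
    than a small multiple of n edges; this leaves a rainbow graph E. Once E has
    appreciably more than (1 - 1/s) n^2 / 2 edges, it contains a K_t, with vertex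
    set K say. Now delete from E every edge whose color occurs on an edge meeting K
    (O(n) colors, hence O(n) edges), and every edge at a vertex met by a color used
    inside K (few vertices, since color classes are small). Only a small multiple
    of n^2 edges are lost, so the step can be repeated q - 1 times
    (exists_isolating). The resulting q - 1 disjoint cliques have t (q - 1) >= p
    vertices in all. Among any q of these vertices, two lie in the same clique, and
    the color of the edge xy between them occurs on no other edge at x. As q >= 3,
    a monochromatic K_q would contain such an edge xy and a further edge xz
    (isolating_copy). *)

(** * Counting arcs: Turan's theorem *)

Lemma card_bigcup_le {I T : finType} (A : {set I}) (F : I -> {set T}) (b : nat) :
  (forall i, i \in A -> #|F i| <= b) -> #|\bigcup_(i in A) F i| <= #|A| * b.
Proof.
move=> leb; rewrite -sum_nat_const.
have le1 : #|\bigcup_(i in A) F i| <= \sum_(i in A) #|F i|.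
  apply: (big_ind2 (fun (X : {set T}) k => #|X| <= k)) => //; first by rewrite cards0.
  move=> X k Y l leX leY; rewrite (leq_trans _ (leq_add leX leY))//.
  by rewrite cardsU leq_subr.
exact/(leq_trans le1)/leq_sum.
Qed.

Section Turan.
Context {T : finType} (e : rel T).
Hypotheses (e_sym : symmetric e) (e_irr : irreflexive e).

(** Ordered pairs are counted, each edge twice: this keeps the halves out of
    Turan's bound. *)
Definition arcs (U : {set T}) : {set T * T} :=
  [set a | [&& a.1 \in U, a.2 \in U & e a.1 a.2]].

Definition clique (S : {set T}) : Prop := {in S &, forall x y, x != y -> e x y}.

(** Turan's theorem by induction on the clique size, after Erdos. Let x have
    maximal degree d in U. If the neighborhood N of x has many arcs, a clique in N
    is extended by x. Otherwise count the arcs with both ends in N by induction and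
    the others by their end outside N, which gives at most
    (1 - 1/r) d^2 + 2 (|U| - d) d <= (1 - 1/(r+1)) |U|^2 arcs. *)
Lemma turan_bound (r : nat) (U : {set T}) :
  r * #|U| ^ 2 < r.+1 * #|arcs U| ->
  exists S : {set T}, [/\ S \subset U, clique S & #|S| = r.+2].
Proof.
elim: r U => [|r IHr] U ltU.
  have /card_gt0P[[x y]] : 0 < #|arcs U| by rewrite mul0n mul1n in ltU.
  rewrite inE /= => /and3P[xU yU exy]; exists [set x; y]; split.
  - by apply/fintype.subsetP => z; rewrite !inE => /orP[] /eqP->.
  - move=> u v; rewrite !inE => /orP[] /eqP-> /orP[] /eqP->; rewrite ?eqxx //.
    by rewrite e_sym.
  - by rewrite cards2; case: eqP exy => // ->; rewrite e_irr.
pose N y := [set z in U | e y z].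
have [x0 x0U] : exists x, x \in U.
  have /card_gt0P[[x y]] : 0 < #|arcs U| by lia.
  by rewrite inE => /andP[xU _]; exists x.
case: (@arg_maxnP _ x0 (mem U) (fun y => #|N y|) x0U) => x /= xU maxx.
have NU y : N y \subset U by apply/fintype.subsetP => z; rewrite inE => /andP[].
have [ltN|leN] := ltnP (r * #|N x| ^ 2) (r.+1 * #|arcs (N x)|).
  have [S [SN Scl cardS]] := IHr _ ltN.
  have xS z : z \in S -> e x z.
    by move/(fintype.subsetP SN); rewrite inE => /andP[].
  exists (x |: S); split.
  - by rewrite finset.subUset finset.sub1set xU (fintype.subset_trans SN).
  - move=> u v; rewrite !inE => /orP[/eqP->|uS] /orP[/eqP->|vS]; rewrite ?eqxx //.
    + by move=> _; apply: xS.
    + by move=> _; rewrite e_sym; apply: xS.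
    + exact: Scl.
  - rewrite cardsU1 cardS; case: (boolP (x \in S)) => // /xS.
    by rewrite e_irr.
have cardC : #|U :\: N x| + #|N x| = #|U|.
  by rewrite cardsD (finset.setIidPr (NU x)) subnK // subset_leq_card.
have le_arcs : #|arcs U| <= #|arcs (N x)| + 2 * (#|U :\: N x| * #|N x|).
  pose out v := [set (v, z) | z in N v]; pose inn v := [set (z, v) | z in N v].
  have leO : #|\bigcup_(v in U :\: N x) out v| <= #|U :\: N x| * #|N x|.
    apply: card_bigcup_le => v; rewrite inE => /andP[_ vU].
    by rewrite (leq_trans (leq_imset_card _ _)) // maxx.
  have leI : #|\bigcup_(v in U :\: N x) inn v| <= #|U :\: N x| * #|N x|.
    apply: card_bigcup_le => v; rewrite inE => /andP[_ vU].
    by rewrite (leq_trans (leq_imset_card _ _)) // maxx.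
  have sub : arcs U \subset arcs (N x) :|: (\bigcup_(v in U :\: N x) out v :|:
                                           \bigcup_(v in U :\: N x) inn v).
    apply/fintype.subsetP => -[u v]; rewrite 2!inE /= => /and3P[uU vU euv].
    case: (boolP (u \in N x)) => uN; last first.
      apply/orP; right; rewrite inE; apply/orP; left.
      apply/finset.bigcupP; exists u; first by rewrite !inE in uN *; rewrite uN.
      by apply: imset_f; rewrite inE vU.
    case: (boolP (v \in N x)) => vN; last first.
      apply/orP; right; rewrite inE; apply/orP; right.
      apply/finset.bigcupP; exists v; first by rewrite !inE in vN *; rewrite vN.
      by apply/imsetP; exists u; rewrite // inE uU e_sym.
    by rewrite inE /= uN vN euv.
  apply: (leq_trans (subset_leq_card sub)).
  rewrite (leq_trans (_ : _ <= #|arcs (N x)| + (#|\bigcup_(v in U :\: N x) out v|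
                              + #|\bigcup_(v in U :\: N x) inn v|))) //.
    by rewrite (leq_trans (leq_card_setU _ _).1) // leq_add2l (leq_card_setU _ _).1.
  by rewrite leq_add2l mul2n -addnn leq_add.
exfalso; move: ltU leN le_arcs; rewrite -cardC.
move: #|arcs U| #|arcs (N x)| #|N x| #|U :\: _| => a b d k ltU leN le_arcs.
have h1 : r.+1 * a <= r * d ^ 2 + r.+1 * (2 * (k * d)).
  by rewrite (leq_trans (leq_mul (leqnn r.+1) le_arcs)) // mulnDr leq_add2r.
have h2 : r.+1 * (r.+1 * (k + d) ^ 2) < r.+2 * (r * d ^ 2 + r.+1 * (2 * (k * d))).
  rewrite (leq_trans _ (leq_mul (leqnn r.+2) h1)) //.
  by rewrite mulnCA ltn_pmul2l.
move: h2; rewrite ltnNge => /negP; apply.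
(* Writing |U| = k + d, the sides differ by the square of (r + 1) k - d. *)
have := (nat_Cauchy (r.+1 * k) d).1; rewrite -!mulnn; lia.
Qed.

End Turan.

(** * Edges of a graph *)

Lemma eq_set2 {T : finType} (a b x y : T) :
  [set a; b] = [set x; y] -> (a, b) = (x, y) \/ (a, b) = (y, x).
Proof.
move=> eqs.
have := set21 a b; have := set22 a b; rewrite {1 2}eqs.
have := set21 x y; have := set22 x y; rewrite -{1 2}eqs !inE.
by do 4![case/orP=> /eqP ?]; subst; auto.
Qed.

Lemma card_ordered_pairs {T : finType} (E : {set {set T}}) :
  (forall e, e \in E -> #|e| = 2) ->
  #|[set a : T * T | [set a.1; a.2] \in E]| = 2 * #|E|.
Proof.
move=> E2; rewrite mulnC -sum_nat_const -sum1_card.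
rewrite (partition_big (fun a : T * T => [set a.1; a.2]) (mem E)) /=; last first.
  by move=> a; rewrite inE.
apply: eq_bigr => e eE.
have /cards2P[x [y [nxy def_e]]] : #|e| == 2 by rewrite E2.
have -> : 2 = #|[set (x, y); (y, x)]|.
  by rewrite cards2 xpair_eqE negb_and nxy.
rewrite -sum1_card; apply: eq_bigl => -[u v]; rewrite !inE /= def_e.
apply/andP/orP => [[_ /eqP/eq_set2[]->]|]; rewrite ?eqxx; [by left|by right|].
by case=> /eqP[-> ->]; rewrite ?[_ |: [set x]]finset.setUC -def_e eqxx.
Qed.

Lemma card_edge {G : sgraph} (e : {set G}) : e \in edges G -> #|e| = 2.
Proof.
case/imsetP=> -[x y]; rewrite inE /= => exy ->; rewrite cards2.
by case: (x =P y) exy => // ->; rewrite adj_irr.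
Qed.

Lemma mem_edges {G : sgraph} (x y : G) : ([set x; y] \in edges G) = adj x y.
Proof.
apply/imsetP/idP => [[[u v]]|exy]; last by exists (x, y); rewrite ?inE.
by rewrite inE /= => euv /eq_set2[] [-> ->]; rewrite // adj_sym.
Qed.

Lemma card_edges (G : sgraph) :
  #|[set a : G * G | adj a.1 a.2]| = 2 * #|edges G|.
Proof.
rewrite -card_ordered_pairs; last exact: card_edge.
by apply: eq_card => a; rewrite !inE mem_edges.
Qed.

Lemma mem_edges_complete (n : nat) (e : {set complete n}) :
  (e \in edges (complete n)) = (#|e| == 2).
Proof.
apply/idP/idP => [/card_edge->//|/cards2P[x [y [nxy ->]]]].
by rewrite mem_edges.
Qed.

(** * Extremal graphs without complete subgraphs *)

Lemma ord_injection {T : finType} (A : {set T}) (k : nat) :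
  k <= #|A| -> exists2 phi : 'I_k -> T, injective phi & forall i, phi i \in A.
Proof.
move=> kA; exists (fun i => enum_val (widen_ord kA i)).
  by move=> i j /enum_val_inj/(congr1 val)/= /val_inj.
by move=> i; apply: enum_valP.
Qed.

Lemma clique_subgraph (G : sgraph) (S : {set G}) :
  clique (@adj G) S -> subgraph (complete #|S|) G.
Proof.
have [phi phi_inj phiS] := ord_injection S #|S| (leqnn _).
move=> Scl; exists phi; split=> // x y /= nxy.
by apply: Scl => //; rewrite (inj_eq phi_inj).
Qed.

Lemma turan_upper (s : nat) (G : sgraph) : 0 < s ->
  ~ subgraph (complete s.+1) G -> s * (2 * #|edges G|) <= s.-1 * #|G| ^ 2.
Proof.
case: s => // r _ noK; rewrite leqNgt; apply/negP => ltG; apply: noK.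
have [] := @turan_bound G (@adj G) (@adj_sym G) (@adj_irr G) r finset.setT.
  rewrite cardsT (leq_trans ltG) // -card_edges leq_mul2l /=.
  by apply/subset_leq_card/fintype.subsetP => a; rewrite !inE.
by move=> S [_ Scl <-]; apply: clique_subgraph.
Qed.

(** The Turan graph: its parts are the residue classes modulo s. *)
Section TuranGraph.
Variables n s : nat.

Let cross (x y : 'I_n) := x %% s != y %% s.

Let cross_sym : symmetric cross.
Proof. by move=> x y; rewrite /cross eq_sym. Qed.

Let cross_irr : irreflexive cross.
Proof. by move=> x; rewrite /cross eqxx. Qed.

Definition turan_graph : sgraph := SGraph cross_sym cross_irr.

Hypothesis s_gt0 : 0 < s.

(** By the pigeonhole principle, two of s + 1 vertices lie in one part. *)
Lemma turan_graph_free : ~ subgraph (complete s.+1) turan_graph.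
Proof.
case=> phi [phi_inj phi_adj].
pose part (i : 'I_s.+1) : 'I_s := Ordinal (ltn_pmod (phi i) s_gt0).
suff /leq_card : injective part by rewrite !card_ord ltnn.
move=> i j /(congr1 val) /= eqij; apply/eqP; apply: contraT => nij.
by have := phi_adj i j nij; rewrite /= /cross eqij eqxx.
Qed.

Lemma card_residue_class (i : 'I_n) :
  #|[set j : 'I_n | j %% s == i %% s]| <= (n %/ s).+1.
Proof.
have quo_lt (j : 'I_n) : j %/ s < (n %/ s).+1 by rewrite ltnS leq_div2r // ltnW.
pose quo j := Ordinal (quo_lt j).
rewrite -[X in _ <= X]card_ord -(@card_in_imset _ _ quo) ?max_card //.
move=> j k; rewrite !inE => /eqP ji /eqP ki /(congr1 val)/= eq_quo.
by apply: val_inj; rewrite /= (divn_eq j s) (divn_eq k s) eq_quo ji ki.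
Qed.

(** The complement of the graph has few arcs, because each of the n vertices lies
    in a residue class of at most n/s + 1 elements. *)
Lemma card_turan_graph :
  s * n ^ 2 <= s * (2 * #|edges turan_graph|) + n ^ 2 + s * n.
Proof.
rewrite -card_edges.
pose same (i : 'I_n) := [set (i, j) | j in [set j : 'I_n | j %% s == i %% s]].
have le_same : #|\bigcup_(i in [set: 'I_n]) same i| <= n * (n %/ s).+1.
  rewrite -[X in X * _]card_ord -cardsT; apply: card_bigcup_le => i _.
  by rewrite (leq_trans (leq_imset_card _ _)) // card_residue_class.
have cover : n * n <= #|[set a : turan_graph * turan_graph | adj a.1 a.2]|
                      + n * (n %/ s).+1.
  rewrite -[X in X * _]card_ord -[X in _ * X]card_ord -card_prod -cardsT.
  rewrite (leq_trans _ (leq_add (leqnn _) le_same)) //.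
  rewrite (leq_trans _ (leq_card_setU _ _).1) //.
  apply/subset_leq_card/fintype.subsetP => -[i j] _; rewrite 2!inE /=.
  rewrite /cross; case: eqP => //= eqij; apply/finset.bigcupP; exists i; first by rewrite inE.
  by apply/imsetP; exists j; rewrite ?inE ?eqij.
move: cover; move: #|[set a | _]| => m cover.
have := leq_trunc_div n s; rewrite -!mulnn; nia.
Qed.

End TuranGraph.

(** * Monochromatic cliques and bad colorings *)

Section ColorClass.
Context {G H : sgraph} {c : coloring H} {phi : G -> H} {k : nat}.

Lemma copy_edge (x y : G) : adj x y -> [set phi x; phi y] \in copy_edges phi.
Proof.
move=> xy; apply/imsetP; exists [set x; y]; first by rewrite mem_edges.
by rewrite finset.imsetU1 finset.imset_set1.
Qed.

(** A monochromatic clique with at least two vertices in a copy gives a complete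
    subgraph of a color class. A single vertex would not do: color classes have no
    isolated vertices. *)
Lemma color_class_containing (Q : {set G}) : injective phi ->
  1 < #|Q| -> clique (@adj G) Q ->
  (forall x y, x \in Q -> y \in Q -> x != y -> c [set phi x; phi y] = k) ->
  occurs c phi k /\ containing (complete #|Q|) (color_class c phi k).
Proof.
move=> phi_inj /card_gt1P Q2 Qcl Qk.
have Qe x y : x \in Q -> y \in Q -> x != y ->
    [set phi x; phi y] \in [set e in copy_edges phi | c e == k].
  move=> xQ yQ nxy; rewrite inE Qk // eqxx andbT.
  by apply: copy_edge; apply: Qcl.
split.
  have [x [y [xQ yQ nxy]]] := Q2.
  by exists [set phi x; phi y]; [apply/copy_edge/Qcl | apply: Qk].
have [f f_inj fQ] := ord_injection Q #|Q| (leqnn _).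
have cov i : phi (f i) \in finset.cover [set e in copy_edges phi | c e == k].
  have [y yQ ny] : exists2 y, y \in Q & f i != y.
    have [x [y [xQ yQ nxy]]] := Q2.
    by case: (eqVneq (f i) x) => [->|]; [exists y | exists x].
  by apply/finset.bigcupP; exists [set phi (f i); phi y]; rewrite ?set21 ?Qe.
exists (fun i => exist _ (phi (f i)) (cov i)); split.
  by move=> i j /(congr1 val)/= /phi_inj/f_inj.
move=> i j /= nij; have fij : f i != f j by rewrite (inj_eq f_inj).
rewrite Qe ?fQ // andbT; apply: contra fij => /eqP/(congr1 val)/= /phi_inj->.
exact: eqxx.
Qed.

(** As q > 1, each vertex of a K_q in the color class lies on an edge of the copy,
    so the monochromatic clique stays inside the copy. *)
Lemma color_class_clique (q : nat) :
  1 < q -> containing (complete q) (color_class c phi k) ->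
  exists Q : {set H}, [/\ #|Q| = q, forall x, x \in Q -> exists i, x = phi i &
    forall x y, x \in Q -> y \in Q -> x != y -> c [set x; y] = k].
Proof.
move=> q1 [psi [psi_inj psi_adj]].
have psiE i j : i != j -> [set val (psi i); val (psi j)] \in copy_edges phi /\
    c [set val (psi i); val (psi j)] = k.
  move=> nij; have := psi_adj i j nij; rewrite /= => /andP[_].
  by rewrite inE => /andP[? /eqP].
exists [set val (psi i) | i in [set: 'I_q]]; split.
- rewrite card_imset ?cardsT ?card_ord //.
  by move=> i j /val_inj/psi_inj.
- move=> _ /imsetP[i _ ->].
  have [j nij] : exists j, i != j.
    have /card_gt1P[j [l [_ _ njl]]] : 1 < #|'I_q| by rewrite card_ord.
    by case: (eqVneq i j) => [->|]; [exists l | exists j].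
  have [/imsetP[e _ def_e] _] := psiE i j nij.
  have := set21 (val (psi i)) (val (psi j)); rewrite def_e => /imsetP[x _ ->].
  by exists x.
- move=> _ _ /imsetP[i _ ->] /imsetP[j _ ->] nij.
  by apply: (psiE i j _).2; apply: contraNneq nij => ->.
Qed.

End ColorClass.

(** A bad coloring with many colors: the Turan graph is rainbow (its edges get the
    positive colors), everything else has color 0. Each copy of K_p has q vertices
    in the same part, so the class of color 0 contains K_q. *)
Lemma turan_coloring (n p q s : nat) : 0 < s -> 1 < q -> s * q.-1 < p ->
  exists2 c : coloring (complete n), #|edges (turan_graph n s)| <= ncolors c &
    forall phi : complete p -> complete n, embedding phi ->
      exists2 k, occurs c phi k & containing (complete q) (color_class c phi k).
Proof.
move=> s0 q1 ltp.
pose c (e : {set complete n}) : nat :=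
  if e \in edges (turan_graph n s) then (enum_rank e).+1 else 0.
exists c.
  rewrite cardE -(size_map c); apply: uniq_leq_size.
    rewrite map_inj_in_uniq ?enum_uniq // => e e'; rewrite !mem_enum /c => -> ->.
    by case=> /val_inj/enum_rank_inj.
  move=> k /mapP[e]; rewrite mem_enum mem_undup => eT ->; apply: map_f.
  by rewrite mem_enum mem_edges_complete (card_edge _ eT).
move=> phi [phi_inj _].
pose part (i : 'I_s) := [set x : 'I_p | phi x %% s == i].
have [i lti] : exists i, q <= #|part i|.
  apply: contrapT => no_i; move: ltp; rewrite ltnNge => /negP; apply.
  rewrite -[X in X <= _]card_ord -cardsT.
  rewrite -[X in _ <= X * _]card_ord -[X in _ <= X * _]cardsT.
  have sub : [set: 'I_p] \subset \bigcup_(i in [set: 'I_s]) part i.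
    apply/fintype.subsetP => x _; apply/finset.bigcupP.
    by exists (Ordinal (ltn_pmod (phi x) s0)); rewrite !inE.
  apply: (leq_trans (subset_leq_card sub)); apply: card_bigcup_le => i _.
  rewrite -ltnS (ltn_predK q1) ltnNge.
  by apply/negP => le; apply: no_i; exists i.
have [f f_inj f_part] := ord_injection (part i) q lti.
pose Q : {set complete p} := [set f j | j in [set: 'I_q]].
have cardQ : #|Q| = q by rewrite card_imset // cardsT card_ord.
have [] := @color_class_containing (complete p) (complete n) c phi 0 Q phi_inj.
- by rewrite cardQ.
- by [].
- move=> x y /imsetP[j _ ->] /imsetP[l _ ->] _.
  rewrite /c ifN // (@mem_edges (turan_graph n s)) /= negbK.
  by have := f_part j; have := f_part l; rewrite !inE => /eqP-> /eqP->.
- by rewrite cardQ => occ sub; exists 0.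
Qed.

(** The two families are complementary, so a coloring that refutes the property
    defining f is one of those considered for g. *)
Lemma not_f_propertyP (n m : nat) (G F : sgraph) :
  ~ f_property n G (excluding F) m <->
  exists2 l, m <= l & g_property n G (containing F) l.
Proof.
split=> [noF|[l lem [c lc bad]] propF].
  apply: contrapT => nog; apply: noF => c mc; apply: contrapT => nophi.
  apply: nog; exists (ncolors c) => //; exists c => // phi phi_emb.
  apply: contrapT => nok; apply: nophi; exists phi => // k occ sub.
  by apply: nok; exists k.
have [phi phi_emb good] := propF c (leq_trans lem (eq_leq (esym lc))).
by have [k occ sub] := bad phi phi_emb; case: (good k occ).
Qed.

Lemma f_num_eq_g_num (n : nat) (G F : sgraph) :
  (exists m, g_property n G (containing F) m) ->
  f_num n G (excluding F) = g_num n G (containing F) + 1.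
Proof.
move=> exg; have [g_g g_max] := g_numP exg.
have [f_f f_min] := f_numP n G (excluding F).
rewrite addn1; apply/eqP; rewrite eqn_leq; apply/andP; split.
  apply: f_min; apply: contrapT => /not_f_propertyP[l ltl /g_max].
  by rewrite leqNgt ltl.
rewrite ltnNge; apply/negP => le_fg.
by apply/not_f_propertyP: f_f; exists (g_num n G (containing F)).
Qed.

(** * Rainbow cliques isolated from each other *)

Lemma rainbow_representatives {T : finType} (f : T -> nat) (A : {set T}) :
  exists R : {set T}, [/\ R \subset A, {in R &, injective f} &
    size (undup [seq f x | x in A]) <= #|R|].
Proof.
pose rep k := [pick y in A | f y == k].
exists [set x in A | rep (f x) == Some x]; split.
- by apply/fintype.subsetP => x; rewrite inE => /andP[].
- move=> x y; rewrite !inE => /andP[_ /eqP rx] /andP[_ /eqP ry] fxy.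
  by apply: Some_inj; rewrite -rx -ry fxy.
rewrite cardE -(size_map f); apply: uniq_leq_size; first exact: undup_uniq.
move=> k; rewrite mem_undup => /mapP[x]; rewrite mem_enum => xA ->.
have [y repy] : exists y, rep (f x) = Some y.
  by rewrite /rep; case: pickP => [y _|/(_ x)]; [exists y | rewrite /= xA eqxx].
have /andP[yA /eqP fy] : (y \in A) && (f y == f x).
  by move: repy; rewrite /rep; case: pickP => // z zP [<-].
by rewrite -fy; apply: map_f; rewrite mem_enum inE yA fy repy eqxx.
Qed.

Section Rainbow.
Context {T : finType} (c : {set T} -> nat).

Definition color_edges (k : nat) : {set {set T}} :=
  [set e : {set T} | (#|e| == 2) && (c e == k)].

(** The color classes of a rainbow family are disjoint sets of pairs. *)
Lemma few_large_classes (E : {set {set T}}) (B : nat) :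
  (forall e, e \in E -> #|e| = 2) -> {in E &, injective c} ->
  #|[set e in E | B < #|color_edges (c e)|]| * B.+1 <= #|T| ^ 2.
Proof.
move=> E2 c_inj; set L := [set e in E | _].
have L_E e : e \in L -> e \in E by rewrite inE => /andP[].
pose P : {set {set {set T}}} := [set color_edges (c e) | e in L].
have mem_color e : e \in L -> e \in color_edges (c e).
  by move=> /L_E/E2 e2; rewrite inE e2 !eqxx.
have cardP : #|P| = #|L|.
  apply: card_in_imset => e e' eL e'L eq_class; apply: c_inj; try exact: L_E.
  by have := mem_color e eL; rewrite eq_class inE => /andP[_ /eqP].
have trivP : finset.trivIset P.
  apply/finset.trivIsetP => _ _ /imsetP[e eL ->] /imsetP[e' e'L ->] ne.
  rewrite -finset.setI_eq0; apply: contraNT ne => /finset.set0Pn[d].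
  by rewrite !inE => /andP[/andP[_ /eqP<-] /andP[_ /eqP<-]].
have cover2 : #|finset.cover P| <= #|T| ^ 2.
  have sub : finset.cover P \subset [set [set a.1; a.2] | a in [set: T * T]].
    apply/fintype.subsetP => d /finset.bigcupP[_ /imsetP[e _ ->]].
    rewrite inE => /andP[/cards2P[x [y [_ ->]]] _].
    by apply/imsetP; exists (x, y).
  rewrite (leq_trans (subset_leq_card sub)) // (leq_trans (leq_imset_card _ _)) //.
  by rewrite cardsT card_prod mulnn.
rewrite -cardP -sum_nat_const (leq_trans _ cover2) // -(eqP trivP).
by apply: leq_sum => _ /imsetP[e eL ->]; move: eL; rewrite inE => /andP[].
Qed.

(** The invariant of the greedy choice of cliques. For a union U of m cliques, any
    m + 1 vertices of U include two from one clique, and the edge xy between them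
    is the only edge at x inside U that has its color. The form with arbitrary
    subsets Q avoids naming the cliques. Membership in E is recorded because the
    colors of the edges that survive a deletion from E are absent from the edges at
    the clique that caused it. *)
Definition isolating (E : {set {set T}}) (m : nat) (U : {set T}) : Prop :=
  forall Q : {set T}, Q \subset U -> m < #|Q| -> exists x y : T,
    [/\ x \in Q, y \in Q, x != y, [set x; y] \in E &
      forall z, z \in U -> z != x -> z != y -> c [set x; z] != c [set x; y]].

(** One clique K on r + 2 vertices is found by Turan's theorem. The edges deleted
    before the next one are those whose color occurs at K (at most (r + 2) |T| pairs
    at K, each color on one edge of E), and those at vertices met by a color used
    inside K (at most (r + 2)^2 colors, B edges each). The first deletion protects
    the later cliques from K, the second protects K from the later cliques; the
    first also makes them disjoint from K, since edges at K have colors occurring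
    at K. That U is covered by E makes both deletions effective for all its
    vertices. *)
Lemma exists_isolating (r m B : nat) (E : {set {set T}}) :
  (forall e, e \in E -> #|e| = 2) -> {in E &, injective c} ->
  (forall e, e \in E -> #|color_edges (c e)| <= B) ->
  r * #|T| ^ 2 + r.+1 * (2 * (m * (r.+2 * #|T| + r.+2 ^ 2 * (B * 2) * #|T|)))
    < r.+1 * (2 * #|E|) ->
  exists U : {set T}, [/\ #|U| = m * r.+2, U \subset finset.cover E &
    isolating E m U].
Proof.
elim: m E => [|m IHm] E E2 c_inj E_B ltE.
  exists finset.set0; split; rewrite ?cards0 ?finset.sub0set //.
  by move=> Q; rewrite finset.subset0 => /eqP->; rewrite cards0.
set cost := (_ + _ * #|T|) in ltE IHm.
pose e x y := [set x; y] \in E.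
have e_irr : irreflexive e.
  by move=> x; apply/negP => /E2; rewrite cards2 eqxx.
have e_sym : symmetric e by move=> x y; rewrite /e finset.setUC.
have [|K [_ Kcl cardK]] := @turan_bound T e e_sym e_irr r finset.setT.
  rewrite cardsT (leq_ltn_trans (leq_addr _ _) (leq_trans ltE _)) //.
  rewrite -card_ordered_pairs // leq_mul2l /=.
  by apply/subset_leq_card/fintype.subsetP => a; rewrite !inE.
pose touch (a : T * T) := [set d in E | c d == c [set a.1; a.2]].
pose X := \bigcup_(a in finset.setX K K)
  (if [set a.1; a.2] \in E then finset.cover (color_edges (c [set a.1; a.2])) else finset.set0).
pose star (v : T) := [set [set v; y] | y in [set: T]].
pose bad := (\bigcup_(a in finset.setX K [set: T]) touch a) :|: \bigcup_(v in X) star v.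
have cardX : #|X| <= r.+2 ^ 2 * (B * 2).
  rewrite -cardK -mulnn -cardsX; apply: card_bigcup_le => -[x y] _ /=.
  case: ifP => [/E_B leB|_]; last by rewrite cards0.
  apply: leq_trans (leq_mul leB (leqnn 2)).
  by apply: card_bigcup_le => d; rewrite inE => /andP[/eqP->].
have card_bad : #|bad| <= cost.
  rewrite (leq_trans (leq_card_setU _ _).1) // leq_add //.
    rewrite -cardK -cardsT -cardsX -[X in _ <= X]muln1; apply: card_bigcup_le => a _.
    apply/card_le1P => d; rewrite inE => /andP[dE /eqP cd] d'.
    rewrite [in RHS]inE /= inE; apply/andP/eqP => [[d'E /eqP cd']|->].
      by apply: c_inj => //; rewrite cd cd'.
    by rewrite dE cd.
  rewrite (leq_trans _ (leq_mul cardX (leqnn _))) //; apply: card_bigcup_le => v _.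
  by rewrite (leq_trans (leq_imset_card _ _)) // cardsT.
have sub : E :\: bad \subset E by exact: finset.subsetDl.
have cardE' : #|E| <= #|E :\: bad| + cost.
  rewrite -(cardsID bad E) addnC leq_add2l (leq_trans _ card_bad) //.
  exact/subset_leq_card/finset.subsetIr.
have [||||U [cardU U_cov U_iso]] := IHm (E :\: bad).
- by move=> d /(fintype.subsetP sub)/E2.
- by move=> d d' /(fintype.subsetP sub) dE /(fintype.subsetP sub) d'E; apply: c_inj.
- by move=> d /(fintype.subsetP sub)/E_B.
- have budget a k x y : x + a * (2 * (m.+1 * k)) < a * (2 * y) ->
      forall z, y <= z + k -> x + a * (2 * (m * k)) < a * (2 * z).
    by move=> lty z /(leq_mul (leqnn a)); lia.
  exact: budget ltE _ cardE'.
have not_K z w d : z \in K -> d \in E :\: bad -> c [set z; w] != c d.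
  move=> zK; rewrite inE [d \in bad]inE negb_or -andbA => /and3P[no_touch _ dE].
  apply: contra no_touch => /eqP cd; apply/finset.bigcupP; exists (z, w).
    by rewrite !inE zK.
  by rewrite inE dE cd eqxx.
have UK z : z \in U -> z \notin K.
  move=> /(fintype.subsetP U_cov)/finset.bigcupP[d dE' zd]; apply/negP => zK.
  have /cards2P[u [v [_ def_d]]] : #|d| == 2 by apply/eqP/E2/(fintype.subsetP sub).
  move: zd; rewrite def_d !inE => /orP[] /eqP def_z.
    by have /negP := not_K z v d zK dE'; rewrite def_d def_z eqxx.
  by have /negP := not_K z u d zK dE'; rewrite def_d def_z finset.setUC eqxx.
have UX z x y : z \in U -> x \in K -> y \in K -> [set x; y] \in E ->
    x != z -> c [set x; z] != c [set x; y].
  move=> zU xK yK xyE nxz.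
  have /finset.bigcupP[d dE' zd] := fintype.subsetP U_cov z zU.
  move: dE'; rewrite inE [d \in bad]inE negb_or -andbA => /and3P[_ no_star dE].
  apply: contra no_star => /eqP cxz; apply/finset.bigcupP; exists z.
    apply/finset.bigcupP; exists (x, y); first by rewrite inE xK yK.
    rewrite /= xyE; apply/finset.bigcupP; exists [set x; z]; last exact: set22.
    by rewrite inE cards2 nxz cxz !eqxx.
  have /cards2P[u [v [_ def_d]]] : #|d| == 2 by rewrite E2.
  move: zd; rewrite def_d !inE => /orP[] /eqP->; apply/imsetP.
    by exists v; rewrite ?inE.
  by exists u; rewrite ?inE // finset.setUC.
exists (K :|: U); split.
- rewrite cardsU cardK cardU mulSn (_ : K :&: U = finset.set0) ?cards0 ?subn0 //.
  apply/setP => z; rewrite !inE; apply/negP => /andP[zK zU].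
  by have := UK z zU; rewrite zK.
- rewrite finset.subUset (fintype.subset_trans U_cov) ?andbT; last first.
    apply/fintype.subsetP => z /finset.bigcupP[d /(fintype.subsetP sub) dE zd].
    by apply/finset.bigcupP; exists d.
  apply/fintype.subsetP => x xK.
  have [y yK nxy] : exists2 y, y \in K & x != y.
    have /card_gt1P[u [v [uK vK nuv]]] : 1 < #|K| by rewrite cardK.
    by case: (eqVneq x u) => [->|]; [exists v | exists u].
  by apply/finset.bigcupP; exists [set x; y]; [apply: Kcl | apply: set21].
move=> Q QKU ltQ.
(* Either Q has two vertices in one of the later cliques, or two in K. *)
have [ltQU|leQU] := ltnP m #|Q :&: U|.
  have [|x [y [xQ yQ nxy xyE' xy_iso]]] := U_iso (Q :&: U) _ ltQU.
    exact: finset.subsetIr.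
  exists x, y; split; rewrite ?(fintype.subsetP sub _ xyE') //.
  + by move: xQ; rewrite inE => /andP[].
  + by move: yQ; rewrite inE => /andP[].
  move=> z; rewrite inE => /orP[zK _ _|]; last exact: xy_iso.
  by rewrite finset.setUC not_K.
have /card_gt1P[x [y [xQK yQK nxy]]] : 1 < #|Q :&: K|.
  have : #|Q| <= #|Q :&: K| + #|Q :&: U|.
    rewrite (leq_trans _ (leq_card_setU _ _).1) // subset_leq_card //.
    by rewrite -finset.setIUr finset.subsetI subxx.
  lia.
move: xQK yQK; rewrite !inE => /andP[xQ xK] /andP[yQ yK].
have xyE : [set x; y] \in E by apply: Kcl.
exists x, y; split=> // z; rewrite inE => /orP[zK|zU] nzx nzy.
  have xzE : [set x; z] \in E by apply: Kcl; rewrite // eq_sym.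
  apply/negP => /eqP/(c_inj _ _ xzE xyE)/eq_set2[] [].
    by move=> zy; rewrite zy eqxx in nzy.
  by move=> xy; rewrite xy eqxx in nxy.
by apply: UX; rewrite // eq_sym.
Qed.

End Rainbow.

(** * Upper bound on the number of colors *)

(** In a monochromatic K_q inside U, the isolated edge xy and a third vertex z,
    which exists as q > 2, give two edges xy and xz of the same color. *)
Lemma isolating_copy (n p q : nat) (c : coloring (complete n))
    (E : {set {set 'I_n}}) (U : {set 'I_n}) :
  2 < q -> p <= #|U| -> isolating c E q.-1 U ->
  exists2 phi : complete p -> complete n, embedding phi &
    forall k, occurs c phi k -> excluding (complete q) (color_class c phi k).
Proof.
move=> q2 pU iso; have [phi phi_inj phiU] := ord_injection U p pU.
exists phi; first by split=> // x y nxy; rewrite /= (inj_eq phi_inj).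
move=> k _ /(color_class_clique q (ltnW q2))[Q [cardQ Qphi Qk]].
have QU : Q \subset U by apply/fintype.subsetP => x /Qphi[i ->].
have [|x [y [xQ yQ nxy _ xy_iso]]] := iso Q QU; first by rewrite cardQ (ltn_predK q2).
have /card_gt0P[z] : 0 < #|Q :\: [set x; y]|.
  have := leq_card_setU (Q :\: [set x; y]) [set x; y] => -[leU _].
  have sub : Q \subset Q :\: [set x; y] :|: [set x; y].
    by apply/fintype.subsetP => z zQ; rewrite !inE zQ andbT orNb.
  have := leq_trans (subset_leq_card sub) leU.
  by rewrite cards2 nxy cardQ; lia.
rewrite !inE negb_or -andbA => /and3P[nzx nzy zQ].
have /eqP[] := xy_iso z (fintype.subsetP QU z zQ) nzx nzy.
by rewrite !Qk // eq_sym.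
Qed.

(** With s = r + 1, the number of colors exceeds (1 - 1/s + 1/(D s)) n^2 / 2. The
    margin n^2 / (2 D s) pays for the large color classes, dropped first, and for the
    deletions made while m cliques are chosen. *)
Lemma many_colors_isolating (r m D : nat) : 0 < D -> exists N : nat,
  forall n (c : coloring (complete n)), N <= n ->
  (D * r + 1) * n ^ 2 < 2 * (D * r.+1) * ncolors c ->
  exists (E : {set {set 'I_n}}) (U : {set 'I_n}),
    #|U| = m * r.+2 /\ isolating c E m U.
Proof.
(* Classes with more than n / D1 edges are dropped: there are at most D1 n of
   them. Scaled by 2 D (r + 1), the deletions at vertices met by small classes cost
   K (n / D1) n <= n^2 / 2, and the losses linear in n add up to P n. *)
move=> D0; pose K := 4 * (D * r.+1) * m * r.+2 ^ 2; pose D1 := (2 * K).+1.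
pose P := 2 * (D * r.+1) * (m * r.+2 + D1); exists (2 * P).+1 => n c leN ltc.
have n0 : 0 < n by exact: leq_trans leN.
have [R [Redges R_inj leR]] := rainbow_representatives c (edges (complete n)).
pose B := n %/ D1.
have R2 e : e \in R -> #|e| = 2 by move/(fintype.subsetP Redges)/card_edge.
pose L := [set e in R | B < #|color_edges c (c e)|].
have leL : #|L| <= n * D1.
  have := few_large_classes c R B R2 R_inj; rewrite -/L card_ord => ltL.
  rewrite -(leq_pmul2l n0) mulnA mulnn.
  rewrite (leq_trans _ (leq_mul ltL (leqnn D1))) //.
  by rewrite mulnC -mulnA leq_mul2l (ltnW (ltn_ceil n _)) ?orbT.
have subE : R :\: L \subset R by exact: finset.subsetDl.
have cardE : ncolors c <= #|R :\: L| + n * D1.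
  rewrite (leq_trans leR) // -(cardsID L R) addnC leq_add2l.
  by rewrite (leq_trans _ leL) // subset_leq_card // finset.subsetIr.
have [||||U [cardU _ iso]] := exists_isolating c r m B (R :\: L).
- by move=> e /(fintype.subsetP subE)/R2.
- by move=> d e /(fintype.subsetP subE) dR /(fintype.subsetP subE); apply: R_inj.
- move=> e; rewrite inE => /andP[eL eR].
  by rewrite leqNgt; apply: contra eL => lt; rewrite inE eR.
- rewrite card_ord.
  have leB : 2 * K * B <= n.
    by rewrite (leq_trans _ (leq_trunc_div n D1)) // mulnC leq_mul2l leqnSn orbT.
  have budget : (K * B + P) * n <= n ^ 2 by rewrite -mulnn leq_mul2r; lia.
  have := leq_mul (leqnn (2 * (D * r.+1))) cardE.
  rewrite -(ltn_pmul2l D0); move: ltc budget; rewrite /P /K -!mulnn.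
  by clearbody L; clear; move: #|_| (ncolors c); lia.
by exists (R :\: L), U.
Qed.

(** If f exceeded the bound, then f - 1 colors would already give q - 1 cliques
    isolated from each other, against the minimality of f. *)
Lemma f_num_upper (p q s D : nat) : 2 < q -> 1 < s -> p <= q.-1 * s.+1 -> 0 < D ->
  exists N, forall n, N <= n ->
    2 * (D * s) * f_num n (complete p) (excluding (complete q))
      <= (D * s.-1 + 1) * n ^ 2 + 2 * (D * s).
Proof.
case: s => // r q2 _ lep D0.
have [N HN] := many_colors_isolating r q.-1 D D0; exists N => n leN.
have [_ f_min] := f_numP n (complete p) (excluding (complete q)).
set f := f_num _ _ _ in f_min *; rewrite leqNgt; apply/negP => ltf.
have f0 : 0 < f by case: f ltf {f_min} => //; rewrite muln0.
suff /f_min : f_property n (complete p) (excluding (complete q)) f.-1 by lia.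
move=> c lec.
have [|E [U [cardU iso]]] := HN n c leN.
  rewrite -(ltn_add2r (2 * (D * r.+1))) (leq_trans ltf) //.
  by rewrite -mulnSr leq_mul2l -ltnS -[in X in X <= _](prednK f0) !ltnS lec orbT.
by apply: isolating_copy iso; rewrite ?cardU.
Qed.

(** * Comparison with the Turan number *)

Lemma f_num_lower (n p q s : nat) : 0 < s -> 1 < q -> s * q.-1 < p ->
  s * n ^ 2 <= 2 * s * f_num n (complete p) (excluding (complete q)) + n ^ 2 + s * n.
Proof.
move=> s0 q1 ltp; have [f_f _] := f_numP n (complete p) (excluding (complete q)).
have [c lec bad] := turan_coloring n p q s s0 q1 ltp.
have le_f : #|edges (turan_graph n s)| <= f_num n (complete p) (excluding (complete q)).
  rewrite (leq_trans lec) // leqNgt; apply/negP => ltc.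
  by apply/not_f_propertyP: f_f; exists (ncolors c); [exact: ltnW | exists c].
have := card_turan_graph n s s0; have := leq_mul (leqnn (2 * s)) le_f; lia.
Qed.

Lemma turan_bounds (n s : nat) : 0 < s ->
  2 * s * turan n (complete s.+1) <= s.-1 * n ^ 2 /\
  s * n ^ 2 <= 2 * s * turan n (complete s.+1) + n ^ 2 + s * n.
Proof.
move=> s0.
have T_T : turan_size n (complete s.+1) #|edges (turan_graph n s)|.
  exists (turan_graph n s); split=> //; first by rewrite card_ord.
  exact: turan_graph_free.
have [[G [cardG G_free cardE]] t_max] := turanP (ex_intro _ _ T_T).
split.
  by have := turan_upper s G s0 G_free; rewrite cardG cardE mulnA [s * 2]mulnC.
by have := card_turan_graph n s s0; have := leq_mul (leqnn (2 * s)) (t_max _ T_T); lia.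
Qed.

(** Both numbers are (1 - 1/s) n^2 / 2 up to a small multiple of n^2, and n^2 is at
    most 8 times the Turan number because s >= 2; hence the factor 8 in the choice
    of the precision below. *)
Lemma f_num_turan_close (p q s D : nat) :
  2 < q -> 1 < s -> s * q.-1 < p -> p <= q.-1 * s.+1 -> 0 < D ->
  exists N, forall n, N <= n ->
    let f := f_num n (complete p) (excluding (complete q)) in
    let t := turan n (complete s.+1) in
    D * f <= D.+1 * t /\ D * t <= D * f + t.
Proof.
move=> q2 s2 ltp lep D0; have s0 := ltnW s2.
have D80 : 0 < 8 * D by rewrite muln_gt0.
have [N HN] := f_num_upper p q s (8 * D) q2 s2 lep D80.
(* 24 D s absorbs the linear terms, and n >= 4 yields n^2 <= 8 t. *)
exists (N + 24 * (D * s) + 4) => n leN f t.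
have [tu tl] := turan_bounds n s s0; rewrite -/t in tu tl.
have fl := f_num_lower n p q s s0 (ltnW q2) ltp; rewrite -/f in fl.
have fu := HN n (leq_trans (leq_trans (leq_addr _ _) (leq_addr _ _)) leN).
rewrite -/f in fu.
have n_large : 24 * (D * s) * n <= n ^ 2 by rewrite -mulnn leq_mul2r; lia.
have n_four : 4 * n <= n ^ 2 by rewrite -mulnn leq_mul2r; lia.
have t_quad : n ^ 2 <= 8 * t.
  have : s * (n ^ 2) <= s * (8 * t); last by rewrite leq_pmul2l.
  have : 2 * n ^ 2 <= s * n ^ 2 by rewrite leq_mul2r s2 orbT.
  have := leq_mul (leqnn s) n_four; lia.
have n1 : 1 <= n by lia.
have sn1 : D * s <= D * s * n by rewrite leq_pmulr.
have [r def_s] : exists r, s = r.+1 by exists s.-1; rewrite prednK.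
have fl' := leq_mul (leqnn D) fl; have tl' := leq_mul (leqnn D) tl.
have tu' := leq_mul (leqnn D) tu.
have st : t <= s * t by rewrite leq_pmull.
rewrite def_s /= in fu fl' tl' tu' n_large sn1 st *.
have goal1 : r.+1 * (D * f) <= r.+1 * (D.+1 * t) by lia.
have goal2 : r.+1 * (D * t) <= r.+1 * (D * f + t) by lia.
by split; rewrite -(leq_pmul2l (ltn0Sn r)).
Qed.

Lemma turan_gt0 (n s : nat) : 1 < s -> 2 < n -> 0 < turan n (complete s.+1).
Proof.
move=> s2 n2; have [_] := turan_bounds n s (ltnW s2).
case: (turan _ _) => //; rewrite muln0 add0n -mulnn => le0; exfalso; case: s s2 le0 => // r r1 le0.
have : r * n <= r.+1 by rewrite -(leq_pmul2r (ltnW (ltnW n2))); nia.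
nia.
Qed.

Local Open Scope classical_set_scope.
Local Open Scope ring_scope.

(** The precision is measured by integers D, so that all estimates before this
    point are between natural numbers. *)
Lemma asymptotic_ratio (R : realType) (a b : nat -> nat) (p : nat) :
  (forall n, (p <= n)%N -> (0 < b n)%N) ->
  (forall D, (0 < D)%N -> exists N, forall n, (N <= n)%N ->
     (D * a n <= D.+1 * b n)%N /\ (D * b n <= D * a n + b n)%N) ->
  exists eps : nat -> R, (eps @ \oo --> (0 : R)) /\
    forall n, (p <= n)%N -> (a n)%:R = (1 + eps n) * (b n)%:R.
Proof.
move=> b_gt0 close; exists (fun n => (a n)%:R / (b n)%:R - 1); split; last first.
  move=> n /b_gt0 bn; rewrite addrC subrK divfK //.
  by rewrite pnatr_eq0 -lt0n.
apply/cvgrPdist_le => e e0.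
pose D := (Num.truncn e^-1).+1.
have [N HN] := close D isT.
near=> n.
have [|up lo] := HN n; first by near: n; apply: nbhs_infty_ge.
have bn : (0 < b n)%N by apply: b_gt0; near: n; apply: nbhs_infty_ge.
have D0 : 0 < D%:R :> R by rewrite ltr0n.
have b0 : 0 < (b n)%:R :> R by rewrite ltr0n.
apply: (@le_trans _ _ D%:R^-1); last first.
  by rewrite invf_ple ?posrE // ltW // truncnS_gt.
have upR : D%:R * (a n)%:R <= (D%:R + 1) * (b n)%:R :> R.
  by rewrite natr1 -!natrM ler_nat.
have loR : D%:R * (b n)%:R <= D%:R * (a n)%:R + (b n)%:R :> R.
  by rewrite -!natrM -natrD ler_nat.
have -> : 0 - ((a n)%:R / (b n)%:R - 1) = ((b n)%:R - (a n)%:R) / (b n)%:R :> R.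
  by field; rewrite gt_eqF.
rewrite ler_norml ler_pdivlMr // ler_pdivrMr // mulNr.
rewrite -(ler_pM2l D0) -[X in _ && X](ler_pM2l D0).
rewrite mulrN !mulVKf ?gt_eqF //; apply/andP; split; lra.
Unshelve. all: by end_near.
Qed.

Lemma ceil_divnP (R : realType) (p k : nat) : (0 < k)%N -> (0 < p)%N ->
  exists s : nat, [/\ `|Num.ceil (p%:R / k%:R : R)|%N = s.+1,
    (s * k < p)%N & (p <= k * s.+1)%N].
Proof.
move=> k0 p0; pose x : R := p%:R / k%:R.
have k0R : 0 < k%:R :> R by rewrite ltr0n.
have x0 : 0 < x by rewrite divr_gt0 ?ltr0n.
have : 0 < Num.ceil x by rewrite ceil_gt0.
have := ceil_itv x; case: (Num.ceil x) => [[//|s]|//] /andP[lt le] _.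
exists s; split=> //.
  move: lt; rewrite (_ : s.+1%:Z - 1 = s%:Z); last by lia.
  by rewrite ltr_pdivlMr // -natrM ltr_nat.
by move: le; rewrite ler_pdivrMr // -natrM ler_nat mulnC.
Qed.

Theorem theorem9p32 (R : realType) (q p : nat) (hq : (3 <= q)%N)
    (hp : (2 * q - 1 <= p)%N) :
  (forall n : nat, (p <= n)%N ->
     f_num n (complete p) (excluding (complete q)) =
       (g_num n (complete p) (containing (complete q)) + 1)%N) /\
  exists eps : nat -> R,
    (eps @ \oo --> (0 : R)) /\
    forall n : nat, (p <= n)%N ->
      (f_num n (complete p) (excluding (complete q)))%:R =
        (1 + eps n) *
        (turan n (complete `|Num.ceil (p%:R / (q - 1)%:R : R)|%N))%:R.
Proof.
have q1 : (0 < q - 1)%N by lia.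
have p0 : (0 < p)%N by lia.
have [s [-> ltp lep]] := ceil_divnP R p (q - 1) q1 p0.
rewrite subn1 in ltp lep.
have s2 : (1 < s)%N by rewrite ltnNge; apply/negP => s1; nia.
split=> [n _|].
  have [c _ bad] := turan_coloring n p q s (ltnW s2) (ltnW hq) ltp.
  by apply: f_num_eq_g_num; exists (ncolors c), c.
apply: asymptotic_ratio => [n pn|D D0].
  by apply: turan_gt0 => //; lia.
exact: f_num_turan_close.
Qed.
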